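(* Let $\mu$ be a partition, and let $$C_\mu(x;q,t)=\sum_{\sigma\colon\mu\to\mathbb Z_+} q^{\operatorname{inv}(\sigma)}\,t^{\operatorname{maj}(\sigma)}\,x^\sigma ,$$ the sum being over all fillings $\sigma$ of the diagram of $\mu$ by positive integers. Then $C_\mu(x;q,t)$ is symmetric in the variables $x=x_1,x_2,\dots$.
   Context: $\mathbb Z_+=\{1,2,\dots\}$. For a partition $\mu=(\mu_1\ge\dots\ge\mu_l)$, its diagram is $\{(i,j)\in\mathbb Z_+\times\mathbb Z_+: j\le\mu_i\}$, identified with $\mu$; $(i,j)$ is the cell in row $i$, column $j$, and rows are numbered from bottom to top (French convention), so $(i+1,j)$ is directly above $(i,j)$ and row 1 is the bottom row. A filling is a function $\sigma\colon\mu\to\mathbb Z_+$, and $x^\sigma=\prod_{u\in\mu}x_{\sigma(u)}$, a monomial in infinitely many variables $x_1,x_2,\dots$. $\operatorname{Des}(\sigma)$ is the set of cells $u=(i+1,j)\in\mu$ such that $\sigma(u)>\sigma(v)$, where $v=(i,j)$. Two cells attack each other if either they are two distinct cells in the same row, or they have the form $(i+1,k)$ and $(i,j)$ with $j<k$. The reading order is the total order on cells row by row, from top to bottom, left to right within each row. $\operatorname{Inv}(\sigma)$ is the set of pairs $\{u,v\}$ of attacking cells with $u$ preceding $v$ in reading order and $\sigma(u)>\sigma(v)$. $\operatorname{arm}(u)$ is the number of cells of $\mu$ strictly to the right of $u$ in its row; $\operatorname{leg}(u)$ is the number of cells strictly above $u$ in its column. Define $$\operatorname{maj}(\sigma)=\sum_{u\in\operatorname{Des}(\sigma)}(\operatorname{leg}(u)+1),\qquad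 \operatorname{inv}(\sigma)=|\operatorname{Inv}(\sigma)|-\sum_{u\in\operatorname{Des}(\sigma)}\operatorname{arm}(u).$$ *)

(* Defs.v *)
From HB Require Import structures.
From mathcomp Require Import all_boot all_order all_algebra.
From mathcomp Require Import finmap monalg.
From mathcomp Require Import mathcomp_extra boolp classical_sets functions.
From mathcomp Require Import cardinality fsbigop.

Set Implicit Arguments.
Unset Strict Implicit.
Unset Printing Implicit Defensive.

Import GRing.Theory.
Local Open Scope ring_scope.

(* The alphabet Z_+ = {1, 2, ...}; it also indexes the variables x_1, x_2, ... *)
Definition zpos : Type := {n : nat | (0 < n)%N}.
HB.instance Definition _ := Countable.on zpos.

(* Cells are pairs (row, column), both counted from 1, row 1 at the bottom.
   [nth 0 mu i.-1] is the part mu_i. *)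
Definition diagram (mu : seq nat) : seq (nat * nat) :=
  [seq (i, j) | i <- iota 1 (size mu), j <- iota 1 (nth 0%N mu i.-1)].

Lemma mem_diagram (mu : seq nat) (i j : nat) :
  ((i, j) \in diagram mu) = [&& 0 < i, 0 < j & j <= nth 0 mu i.-1]%N.
Proof.
apply/allpairsPdep/idP => [[i' [j' []]]|/and3P[i0 j0 jle]].
  by rewrite !mem_iota !add1n !ltnS => /andP[? _] /andP[? ?] [-> ->]; apply/and3P.
exists i, j; rewrite !mem_iota !add1n !ltnS i0 j0 jle; split=> //=.
rewrite leqNgt; apply/negP => szi; move: jle.
rewrite nth_default; first by rewrite leqn0 => /eqP j_eq0; rewrite j_eq0 in j0.
by rewrite -ltnS prednK.
Qed.

Definition cell (mu : seq nat) : finType := seq_sub (diagram mu).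

Definition filling (mu : seq nat) : choiceType := {ffun cell mu -> zpos}.

Section Statistics.
Variable mu : seq nat.
Implicit Types u v : cell mu.
Local Open Scope nat_scope.

Definition crow u : nat := (ssval u).1.
Definition ccol u : nat := (ssval u).2.

Definition above u v : bool := (crow u == (crow v).+1) && (ccol u == ccol v).

Definition attack_down u v : bool := (crow u == (crow v).+1) && (ccol v < ccol u).

Definition attack u v : bool :=
  [|| (u != v) && (crow u == crow v), attack_down u v | attack_down v u].

Definition precedes u v : bool :=
  (crow v < crow u) || (crow u == crow v) && (ccol u < ccol v).

Definition arm u : nat := #|[set v | (crow v == crow u) && (ccol u < ccol v)]|.
Definition leg u : nat := #|[set v | (ccol v == ccol u) && (crow u < crow v)]|.

Definition Des (sigma : filling mu) : {set cell mu} :=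
  [set u | [exists v, above u v && (val (sigma v) < val (sigma u))]].

(* An unordered pair {u, v} is recorded as the ordered pair (u, v) in which u
   comes first in the reading order. *)
Definition Inv (sigma : filling mu) : {set cell mu * cell mu} :=
  [set p | [&& attack p.1 p.2, precedes p.1 p.2 &
               val (sigma p.2) < val (sigma p.1)]].

Definition maj_fill (sigma : filling mu) : nat := \sum_(u in Des sigma) (leg u).+1.

Definition inv_fill (sigma : filling mu) : int :=
  (Posz #|Inv sigma| - Posz (\sum_(u in Des sigma) arm u))%R.

Definition xmon (sigma : filling mu) : {cmonom zpos} :=
  \big[mmul/mone]_(u : cell mu) ucm (sigma u).

End Statistics.

(* The coefficient field Q(q,t), so that q may be raised to the exponent
   [inv_fill sigma], which is an integer. *)
Definition Qqt : fieldType := {fraction {poly {poly rat}}}.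
Definition qvar : Qqt := FracField.tofrac ('X)%:P.
Definition tvar : Qqt := FracField.tofrac 'X.

(* Formal power series in x_1, x_2, ...: families of coefficients indexed by
   the monomials. *)
Definition series (K : Type) : Type := {cmonom zpos} -> K.

(* There are infinitely many fillings, but only finitely many of them have a
   given monomial (lemma [finite_xmon_fiber]), so each coefficient is a finite
   sum. *)
Definition Cmu (mu : seq nat) : series Qqt := fun m =>
  \sum_(sigma \in [set sigma : filling mu | xmon sigma = m]%classic)
     (qvar ^ inv_fill sigma * tvar ^+ maj_fill sigma).

(* The monomial obtained from x^m by substituting x_(w i) for x_i. *)
Definition rename (w : zpos -> zpos) (m : {cmonom zpos}) : {cmonom zpos} :=
  \big[mmul/mone]_(i <- finsupp m) expcmn (ucm (w i)) (m i).

(* f(x_(w 1), x_(w 2), ...) = f(x_1, x_2, ...) for every permutation w of Z_+,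
   written coefficientwise. *)
Definition symmetric_series (K : Type) (f : series K) : Prop :=
  forall w : zpos -> zpos, bijective w -> forall m, f (rename w m) = f m.

Lemma xmonE (mu : seq nat) (sigma : filling mu) (i : zpos) :
  xmon sigma i = #|[set u | sigma u == i]|.
Proof.
rewrite /xmon -sum1dep_card.
rewrite (big_morph (fun m : {cmonom zpos} => m i)
          (fun m1 m2 => cmM i m1 m2) (cm1 i)).
by rewrite [RHS]big_mkcond; apply: eq_bigr => u _; rewrite cmU; case: eqP.
Qed.

Lemma finite_xmon_fiber (mu : seq nat) (m : {cmonom zpos}) :
  finite_set [set sigma : filling mu | xmon sigma = m]%classic.
Proof.
pose g (s : {ffun cell mu -> finsupp m}) : filling mu := [ffun u => val (s u)].
apply: (@sub_finite_set _ _ (range g)) => [sigma /= sm|]; last first.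
  exact/finite_image/finite_finset.
have sP u : sigma u \in finsupp m.
  rewrite mem_finsupp -sm xmonE -lt0n card_gt0.
  by apply/set0Pn; exists u; rewrite inE.
by exists [ffun u => [` sP u]%fset] => //; apply/ffunP => u; rewrite !ffunE.
Qed.

(* Main.v *)
From HB Require Import structures.
Require Import Defs.
From mathcomp Require Import classical_sets fsbigop finmap monalg.
From mathcomp Require Import all_boot all_algebra fingroup perm zify.

Set Implicit Arguments.
Unset Strict Implicit.
Unset Printing Implicit Defensive.

Import GRing.Theory.

(* Place the cells on a line in reading order, cell (i, j) at position
   - i * N + j with N larger than every part. Two cells attack each other when
   their distance is less than N, and a cell lies directly above another when it
   comes exactly N earlier. So q^inv t^maj is the product of c(u, v) over all pairs
   with u before v and sigma(u) > sigma(v), where c = q at distance < N, c is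
   some scalar at distance N, and c = 1 beyond.

   It is enough to exchange two consecutive letters, and for this only the cells
   S filled with these two letters matter. So let A be the set of the cells of S
   with the larger letter, weighted by the product of c(u, v) over u in A, v in
   S - A, u before v; the claim is that |A| and |S - A| are exchangeable. Take a
   longest pair (a, b) with c(a, b) <> 1. Resetting c(a, b) to 1 changes the
   sum only at the A with a in A and b not in A, and there every other cell y
   contributes to the weight, together with a and b, a factor that does not
   depend on whether y is in A: q if y is between a and b, and 1 otherwise. So
   the change is a constant times the same sum over S - {a, b}, and one concludes
   by induction on the number of pairs with c <> 1. *)

(** * Subsets weighted by a cut, and their exchange with complements *)

Section CutWeight.
Variables (T : finType) (R : comNzRingType) (pos : T -> nat).
Hypothesis pos_inj : injective pos.
Implicit Types (c : T -> T -> R) (S A : {set T}).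
Local Open Scope ring_scope.

Definition cut_weight c S A : R :=
  \prod_(x in S) \prod_(y in S)
    (if [&& (pos x < pos y)%N, x \in A & y \notin A] then c x y else 1).

(** This is all that is kept of the distance rule. It survives both the removal of cells and the
    resetting of a longest nontrivial pair. *)
Definition nested_const (q : R) c S :=
  forall a b x y, a \in S -> b \in S -> x \in S -> y \in S ->
  (pos a <= pos x)%N -> (pos x < pos y)%N -> (pos y <= pos b)%N ->
  (x, y) != (a, b) -> c a b != 1 -> c x y = q.

Definition reset c (a b x y : T) : R := if (x == a) && (y == b) then 1 else c x y.

Lemma cut_weight_reset c S A a b :
    a \in S -> b \in S -> (pos a < pos b)%N ->
  cut_weight c S A =
  (if (a \in A) && (b \notin A) then c a b else 1) * cut_weight (reset c a b) S A.
Proof.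
move=> aS bS ab; rewrite /cut_weight (bigD1 a) //= (bigD1 b) //=.
rewrite [in RHS](bigD1 a) //= [in RHS](bigD1 b) //= ab /= /reset !eqxx /=.
rewrite if_same mul1r -!mulrA; congr (_ * (_ * _)).
  by apply: eq_bigr => y /andP[_ /negPf->].
by apply: eq_bigr => x /andP[_ /negPf->].
Qed.

(** Another cell [y] is paired with [b] if it lies in [A] and with [a] otherwise. Between [a] and
    [b] either factor is [q] by nesting; elsewhere the pair is in the wrong order or longer than
    [(a, b)], and the factor is 1. *)
Lemma cut_weight_corner (q : R) c S A a b :
    nested_const q c S -> a \in S -> b \in S -> (pos a < pos b)%N -> c a b != 1 ->
    (forall x y, x \in S -> y \in S -> (pos b - pos a < pos y - pos x)%N -> c x y = 1) ->
    A \subset S :\ a :\ b ->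
  cut_weight (reset c a b) S (a |: A) =
  (\prod_(y in S :\ a :\ b | (pos a < pos y < pos b)%N) q) * cut_weight c (S :\ a :\ b) A.
Proof.
move=> nest aS bS ab cab far sA.
have ba : b != a by apply: contraTneq ab => ->; rewrite ltnn.
have aA : a \notin A by apply/negP => /(subsetP sA); rewrite !inE eqxx /= andbF.
have bA : b \notin A by apply/negP => /(subsetP sA); rewrite !inE eqxx.
have baS : b \in S :\ a by rewrite !inE ba.
rewrite /cut_weight (big_setD1 a) // (big_setD1 b) //=.
rewrite [X in _ * (X * _)]big1 ?mul1r; last first.
  by move=> y _; rewrite !inE (negPf ba) (negPf bA) andbF.
rewrite (big_setD1 a) //= ltnn mul1r (big_setD1 b) //= /reset !eqxx if_same mul1r.
under [X in _ * X]eq_bigr => x xS.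
  move: (xS); rewrite !inE => /and3P[xb xa _].
  rewrite (big_setD1 a) // (big_setD1 b) //= !inE eqxx !andbF mul1r (negPf xa) /=.
  over.
rewrite big_split mulrA /=; congr (_ * _); last first.
  apply: eq_bigr => x; rewrite !inE => /and3P[xb xa _].
  by apply: eq_bigr => y; rewrite !inE => /and3P[_ /negPf -> _].
rewrite -big_split [RHS]big_mkcondr /=; apply: eq_bigr => y.
rewrite !inE => /and3P[yb ya yS]; rewrite (negPf ba) (negPf bA) (negPf ya) (negPf yb) /= !andbT.
have pya : pos y != pos a by rewrite (inj_eq pos_inj).
have pyb : pos y != pos b by rewrite (inj_eq pos_inj).
case yA: (y \in A); rewrite /= ?andbF ?andbT ?mul1r ?mulr1.
- case: ltnP => yb'; last by rewrite andbF.
  rewrite andbT; case: ltnP => ya'.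
    apply: (nest a b y b) => //; first exact: ltnW.
    by rewrite xpair_eqE (negPf ya).
  by apply: far => //; move: pya ya' yb' ab; clear; lia.
- rewrite eqxx /=; case: ltnP => //= ya'; case: ltnP => yb'.
    apply: (nest a b a y) => //; first exact: ltnW.
    by rewrite xpair_eqE (negPf yb) andbF.
  by apply: far => //; move: pyb ya' yb' ab; clear; lia.
Qed.

(* [phi] is arbitrary so that the induction can replace it by
   [fun n m => phi n.+1 m.+1] when the pair [a, b] is removed. *)
Lemma cut_weight_symmetry (q : R) c S (phi : nat -> nat -> R) :
    nested_const q c S ->
  \sum_(A in powerset S) phi #|A| #|S :\: A| * cut_weight c S A =
  \sum_(A in powerset S) phi #|S :\: A| #|A| * cut_weight c S A.
Proof.
pose bad c S := [set p | [&& p.1 \in S, p.2 \in S, (pos p.1 < pos p.2)%N & c p.1 p.2 != 1]].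
have [n] := ubnP #|bad c S|; elim: n => // n IHn in c S phi * => badS nest.
have [bad0|[p0 p0bad]] := set_0Vmem (bad c S).
  have w1 A : cut_weight c S A = 1.
    rewrite /cut_weight big1 // => x xS; rewrite big1 // => y yS.
    case: ifP => // /and3P[xy _ _]; apply/eqP/negPn/negP => cxy.
    by have := in_set0 (x, y); rewrite -bad0 inE /= xS yS xy cxy.
  (* All weights being 1, complementation in [S] exchanges the two cardinals. *)
  under eq_bigr do rewrite w1; under [RHS]eq_bigr do rewrite w1.
  rewrite (reindex_onto (fun A => S :\: A) (fun A => S :\: A)) /=; last first.
    by move=> A; rewrite powersetE => sA; rewrite setDDr setDv set0U; apply/setIidPr.
  apply: eq_big => A; rewrite !powersetE subsetDl /=.
    by rewrite setDDr setDv set0U; apply/eqP/idP => [<-|/setIidPr//]; rewrite subsetIl.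
  by move/eqP=> ->.
case: (@arg_maxnP _ p0 (mem (bad c S)) (fun p => pos p.2 - pos p.1)%N p0bad).
case=> a b; rewrite /= inE /= => /and4P[aS bS ab cab] mx.
have far x y : x \in S -> y \in S -> (pos b - pos a < pos y - pos x)%N -> c x y = 1.
  move=> xS yS d; apply/eqP/negPn/negP => cxy.
  have /mx /= : (x, y) \in bad c S.
    by rewrite inE /= xS yS cxy andbT /=; lia.
  by rewrite leqNgt d.
set c' := reset c a b; set S' := S :\ a :\ b.
have ba : b != a by apply: contraTneq ab => ->; rewrite ltnn.
have abbad : (a, b) \in bad c S by rewrite inE /= aS bS ab.
(* [psi] is arbitrary because this serves both for [phi] and for [phi] with its arguments
   swapped. *)
have sum_reset (psi : nat -> nat -> R) :
  \sum_(A in powerset S) psi #|A| #|S :\: A| * cut_weight c S A =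
  \sum_(A in powerset S) psi #|A| #|S :\: A| * cut_weight c' S A
  + (c a b - 1) * (\prod_(y in S' | (pos a < pos y < pos b)%N) q) *
     \sum_(A in powerset S') psi #|A|.+1 #|S' :\: A|.+1 * cut_weight c S' A.
  transitivity (
     \sum_(A in powerset S) psi #|A| #|S :\: A| * cut_weight c' S A +
     \sum_(A in powerset S | (a \in A) && (b \notin A))
       (c a b - 1) * (psi #|A| #|S :\: A| * cut_weight c' S A)).
    rewrite [X in _ = _ + X]big_mkcondr -big_split /=; apply: eq_bigr => A _.
    rewrite (@cut_weight_reset c S A a b) // -/c'; case: ifP => _; last by rewrite mul1r addr0.
    by rewrite mulrBl mul1r addrCA subrr addr0 mulrCA.
  congr (_ + _); rewrite -mulr_sumr -mulrA; congr (_ * _); rewrite mulr_sumr.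
  rewrite (reindex_onto (fun A => a |: A) (fun A => A :\ a)) /=; last first.
    by move=> A /and3P[_ aA _]; rewrite setD1K.
  apply: eq_big => A.
    rewrite !powersetE subUset sub1set aS setU11 !inE (negPf ba) /=.
    rewrite /S' !subsetD1 -!andbA; congr (_ && _); rewrite andbC; congr (_ && _).
    apply/eqP/idP => [<-|aA]; first by rewrite !inE eqxx.
    by rewrite setU1K.
  move=> /andP[/and3P[]]; rewrite powersetE subUset => /andP[_ sA] _.
  rewrite !inE (negPf ba) /= => bA /eqP eA.
  have aA : a \notin A by rewrite -eA !inE eqxx.
  have sA' : A \subset S' by rewrite !subsetD1 sA aA bA.
  rewrite (cut_weight_corner nest) // mulrCA; congr (_ * (psi _ _ * _)).
    by rewrite cardsU1 aA.
  have -> : S :\: (a |: A) = b |: (S' :\: A).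
    apply/setP=> x; rewrite !inE; case: (eqVneq x b) => [->|xb] /=.
      by rewrite (negPf ba) bA bS.
    by rewrite negb_or; case: eqP => //=; rewrite andbF.
  by rewrite cardsU1 !inE eqxx andbF.
have bad_sub c1 S1 : bad c1 S1 \subset bad c S -> (a, b) \notin bad c1 S1 -> (#|bad c1 S1| < n)%N.
  move=> s1 n1; rewrite ltnS in badS; apply: leq_trans badS; apply: proper_card.
  by apply/properP; split=> //; exists (a, b).
rewrite sum_reset (sum_reset (fun k l => phi l k)); congr (_ + _ * _).
- apply: IHn => [|u v x y uS vS xS yS ux xy yv xyuv].
    apply: bad_sub; last by rewrite inE /= /c' /reset !eqxx /= ?eqxx ?andbF.
    apply/subsetP => -[x y]; rewrite !inE /= => /and4P[-> -> -> /=].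
    by rewrite /c' /reset; case: ifP => //; rewrite eqxx.
  rewrite /c' /reset; case: ifP => uvab; first by rewrite eqxx.
  move=> cuv; case: ifP => [/andP[/eqP xa /eqP yb]|_]; last exact: (nest u v).
  (* The reset pair has lost its weight, so no nontrivial pair may properly contain it: such a pair
     would be longer than [(a, b)]. *)
  subst x y; case/eqP: cuv; apply: far => //.
  have: (pos u != pos a) || (pos v != pos b).
    rewrite !(inj_eq pos_inj) -negb_and; exact: negbT.
  by move: ux yv ab; clear; lia.
- have sS x : x \in S' -> x \in S by rewrite !inE => /and3P[].
  apply: (IHn c S' (fun n m => phi n.+1 m.+1)) => [|u v x y /sS uS /sS vS /sS xS /sS yS].
    apply: bad_sub; last by rewrite !inE /= !eqxx /= andbF.
    by apply/subsetP => -[x y]; rewrite !inE /= => /and4P[/and3P[_ _ ->] /and3P[_ _ ->] -> ->].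
  exact: nest.
Qed.

End CutWeight.

(** * Fillings by a finite alphabet, and permutations of their content *)

Section FillingWeight.
Variables (T : finType) (R : comNzRingType) (pos : T -> nat).
Hypothesis pos_inj : injective pos.
Variables (q : R) (c : T -> T -> R).
Hypothesis nest : nested_const pos q c setT.
Local Open Scope ring_scope.

Variable L : nat.
Implicit Types (s r : {ffun T -> 'I_L}) (e : 'I_L -> nat) (i j k : 'I_L).

Definition filling_weight s : R :=
  \prod_x \prod_y (if (pos x < pos y)%N && (s y < s x)%N then c x y else 1).

Definition letter_set s k : {set T} := [set x | s x == k].

Definition content_sum e : R :=
  \sum_(s | [forall k, #|letter_set s k| == e k]) filling_weight s.

Lemma eq_content_sum e e' : e =1 e' -> content_sum e = content_sum e'.
Proof. by move=> ee'; apply: eq_bigl => s; apply: eq_forallb => k; rewrite ee'. Qed.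

Definition merge_letter i j s : {ffun T -> 'I_L} :=
  [ffun x => if s x == j then i else s x].

Definition split_letter j r (A : {set T}) : {ffun T -> 'I_L} :=
  [ffun x => if x \in A then j else r x].

Section Split.
Variables (i j : 'I_L) (r : {ffun T -> 'I_L}) (A : {set T}).
Hypotheses (ij : j = i.+1 :> nat) (rj : forall x, r x != j).
Hypothesis sA : A \subset letter_set r i.

Lemma letter_set_split k :
  letter_set (split_letter j r A) k =
  if k == j then A else if k == i then letter_set r i :\: A else letter_set r k.
Proof.
have neq_ij : i != j by rewrite -(inj_eq val_inj) /= ij neq_ltn ltnSn.
apply/setP => x; rewrite inE ffunE; case xA: (x \in A).
  have /[!inE]/eqP rx := subsetP sA x xA.
  rewrite eq_sym; case: eqVneq => [_|kj]; first by rewrite xA.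
  case: eqVneq => [_|ki]; rewrite !inE ?xA //.
  by rewrite rx eq_sym (negPf ki).
case: (eqVneq k j) => [->|kj]; first by rewrite (negPf (rj x)) xA.
by case: (eqVneq k i) => [->|ki]; rewrite !inE ?xA.
Qed.

(** As [i] and [j] are consecutive, raising the cells of [A] from [i] to [j] alters no comparison
    with a third letter. The only new decreasing pairs lead from [A] to the cells still filled with
    [i]. *)
Lemma filling_weight_split :
  filling_weight (split_letter j r A) =
  filling_weight r * cut_weight pos c (letter_set r i) A.
Proof.
rewrite /filling_weight /cut_weight [X in _ * X]big_mkcond -big_split /=.
apply: eq_bigr => x _; rewrite ffunE inE.
have AS y : y \in A -> r y = i by move/(subsetP sA); rewrite inE => /eqP.
have nrj y : r y != j :> nat by apply: contraNneq (rj y) => /val_inj ->.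
case: (eqVneq (r x) i) => [rx|rxi].
  rewrite [X in _ * X]big_mkcond -big_split /=; apply: eq_bigr => y _.
  rewrite ffunE inE rx; case: ltnP => // _ /=; last by rewrite if_same mulr1.
  case: (eqVneq (r y) i) => [ry|ryi].
    rewrite ry ltnn mul1r.
    by case: (x \in A); case: (y \in A); rewrite /= ?ltnn // ij ?ltnSn // ltnNge leqnSn.
  have yA : y \notin A by apply: contra ryi => /AS ->.
  rewrite (negPf yA) mulr1; congr (if _ then _ else _).
  have := nrj y; have : r y != i :> nat by apply: contra ryi => /eqP/val_inj ->.
  by case: (x \in A); rewrite ?ij; clear; lia.
have xA : x \notin A by apply: contra rxi => /AS ->.
rewrite mulr1 (negPf xA); apply: eq_bigr => y _; rewrite ffunE.
case yA: (y \in A) => //; rewrite (AS y yA); congr (if _ && _ then _ else _).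
have := nrj x; have : r x != i :> nat by apply: contra rxi => /eqP/val_inj ->.
by rewrite ij; clear; lia.
Qed.

End Split.

(** Fillings are grouped by the result [r] of merging [j] into [i]. Each group is parametrized by
    the set [A] of cells that held [j], and the symmetry of cut weights applies to it. *)
Lemma content_sum_adjacent i j e :
  j = i.+1 :> nat -> content_sum (e \o tperm i j) = content_sum e.
Proof.
move=> ij; have neq_ij : i != j by rewrite -(inj_eq val_inj) /= ij neq_ltn ltnSn.
rewrite /content_sum (partition_big (merge_letter i j) predT) //=.
rewrite [RHS](partition_big (merge_letter i j) predT) //=.
apply: eq_bigr => r _.
have [/forallP rj|] := boolP [forall x, r x != j]; last first.
  rewrite negb_forall => /existsP[x /negPn/eqP rx].
  (* A merged filling never takes the value [j], so both groups are empty. *)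
  have no s (b : bool) : b && (merge_letter i j s == r) = false.
    apply/negbTE/nandP; right; apply/negP => /eqP/ffunP/(_ x); rewrite ffunE rx.
    by case: eqVneq => [_ /eqP|/eqP//]; rewrite (negPf neq_ij).
  by rewrite !big_pred0.
have key e' :
  \sum_(s | [forall k, #|letter_set s k| == e' k] && (merge_letter i j s == r))
     filling_weight s =
  filling_weight r * \sum_(A in powerset (letter_set r i))
    ([&& #|A| == e' j, #|letter_set r i :\: A| == e' i &
       [forall k, (k != i) && (k != j) ==> (#|letter_set r k| == e' k)]]%:R *
     cut_weight pos c (letter_set r i) A).
  rewrite (reindex_onto (split_letter j r) (fun s => letter_set s j)) /=; last first.
    move=> s /andP[_ /eqP<-]; apply/ffunP => x; rewrite !ffunE inE.
    by case: eqVneq.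
  rewrite mulr_sumr big_mkcond [RHS]big_mkcond; apply: eq_bigr => A _ /=.
  rewrite powersetE; have [sA|nsA] := boolP (A \subset letter_set r i); last first.
    case: ifP => // /andP[/andP[_ /eqP/ffunP mr] /eqP Aj]; case/negP: nsA.
    by apply/subsetP=> x xA; rewrite inE -mr !ffunE xA eqxx.
  have -> : merge_letter i j (split_letter j r A) == r.
    apply/eqP/ffunP => x; rewrite !ffunE; case: (boolP (x \in A)) => [xA|_]; last first.
      by rewrite (negPf (rj x)).
    by have := subsetP sA x xA; rewrite inE eqxx => /eqP.
  rewrite (letter_set_split ij rj sA) !eqxx !andbT (filling_weight_split ij rj sA) mulrCA.
  have -> : [forall k, #|letter_set (split_letter j r A) k| == e' k] =
     [&& #|A| == e' j, #|letter_set r i :\: A| == e' i &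
       [forall k, (k != i) && (k != j) ==> (#|letter_set r k| == e' k)]].
    apply/forallP/and3P => [H|[Aj Ai /forallP H] k].
      have := H j; rewrite (letter_set_split ij rj sA) eqxx => Aj.
      have := H i; rewrite (letter_set_split ij rj sA) (negPf neq_ij) eqxx => Ai.
      split=> //; apply/forallP => k; apply/implyP => /andP[ki kj].
      by have := H k; rewrite (letter_set_split ij rj sA) (negPf ki) (negPf kj).
    rewrite (letter_set_split ij rj sA); case: (eqVneq k j) => [->//|kj].
    case: (eqVneq k i) => [->//|ki].
    by have := H k; rewrite ki kj.
  by case: ifP => _; rewrite ?mul1r ?mul0r.
rewrite !key; congr (_ * _).
pose out := [forall k, (k != i) && (k != j) ==> (#|letter_set r k| == e k)].
have nestS : nested_const pos q c (letter_set r i).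
  by move=> a b x y _ _ _ _; apply: nest; rewrite inE.
(* [phi] is the indicator of the prescribed content; its part [out], on the other letters, does not
   depend on [A]. *)
rewrite -[RHS](cut_weight_symmetry pos_inj
   (fun n m => [&& m == e j, n == e i & out]%:R) nestS).
apply: eq_bigr => A _; congr (_%:R * _); rewrite /= tpermL tpermR.
rewrite andbCA /out; congr [&& _, _ & _]; apply: eq_forallb => k.
case: (eqVneq k i) => //= ki; case: (eqVneq k j) => //= kj.
by rewrite tpermD // eq_sym.
Qed.

(** Induction on the distance: with [k] just below [j], the transposition of [i] and [j] is that of
    [i] and [k] conjugated by the adjacent one of [k] and [j]. *)
Lemma content_sum_tperm i j e : content_sum (e \o tperm i j) = content_sum e.
Proof.
have: forall n i j e, j = (i + n.+1)%N :> nat -> content_sum (e \o tperm i j) = content_sum e.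
  elim=> [|n IHn] {}i {}j {}e ijn; first by apply: content_sum_adjacent; rewrite ijn addn1.
  have kL : (i + n.+1 < L)%N by apply: leq_trans (ltn_ord j); rewrite ijn !addnS.
  pose k := Ordinal kL.
  have ki : k != i by rewrite -(inj_eq val_inj) neq_ltn /= addnS !ltnS leq_addr orbT.
  have ji : j != i by rewrite -(inj_eq val_inj) neq_ltn /= ijn addnS !ltnS leq_addr orbT.
  have jk : j = k.+1 :> nat by rewrite ijn addnS.
  have -> : tperm i j = (tperm k j * tperm i k * tperm k j)%g.
    by rewrite -{1}(tpermV k j) -mulgA -/(conjg _ _) tpermJ tpermL tpermD.
  rewrite -[RHS](content_sum_adjacent e jk) -[RHS](IHn i k _ erefl).
  rewrite -[RHS](content_sum_adjacent _ jk).
  by apply: eq_content_sum => x /=; rewrite !permM.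
move=> H; case: (ltngtP i j) => ij.
- by apply: (H (j - i.+1)%N); rewrite -subSn // subSS subnKC // ltnW.
- by rewrite tpermC; apply: (H (i - j.+1)%N); rewrite -subSn // subSS subnKC // ltnW.
- by apply: eq_content_sum => x /=; rewrite (val_inj ij) tperm1 perm1.
Qed.

Lemma content_sum_perm (w : 'S_L) e : content_sum (e \o w) = content_sum e.
Proof.
have [ts -> _] := prod_tpermP w; elim: ts e => [|t ts IHts] e.
  by apply: eq_content_sum => x; rewrite /= big_nil perm1.
rewrite big_cons -[RHS]IHts -[RHS](content_sum_tperm t.1 t.2).
by apply: eq_content_sum => x /=; rewrite permM.
Qed.

End FillingWeight.

(** * The reading order as positions, and the statistics as pair weights *)

Section Position.
Variable mu : seq nat.
Implicit Types u v : cell mu.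
Local Open Scope nat_scope.

Definition width : nat := (\max_u @ccol mu u).+1.
Definition height : nat := \max_u @crow mu u.
(** Counting rows down from [height] keeps the values natural; as [width] exceeds every column,
    distinct rows occupy disjoint intervals. *)
Definition position u : nat := (height - crow u) * width + ccol u.

Lemma ccol_lt u : ccol u < width. Proof. by rewrite ltnS (leq_bigmax u). Qed.
Lemma crow_le u : crow u <= height. Proof. exact: (leq_bigmax u). Qed.

Lemma position_lt u v : (position u < position v) = precedes u v.
Proof.
rewrite /position /precedes.
move: (ccol_lt u) (ccol_lt v) (crow_le u) (crow_le v).
move: (crow u) (crow v) (ccol u) (ccol v) width height; clear.
move=> ru rv cu cv w h uw vw uh vh.
case: (ltngtP rv ru) => [lt|lt|->] /=; last by rewrite ltn_add2l.
  have -> : h - rv = (h - ru) + (ru - rv.+1).+1 by lia.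
  by rewrite mulnDl mulSn -addnA ltn_add2l; apply/idP; nia.
have -> : h - ru = (h - rv) + (rv - ru.+1).+1 by lia.
by rewrite mulnDl mulSn -addnA ltn_add2l; apply/negbTE; rewrite -leqNgt; nia.
Qed.

Lemma position_inj : injective position.
Proof.
move=> u v uv; have := position_lt u v; have := position_lt v u.
rewrite uv ltnn /precedes => vu' uv'; have [] : crow u = crow v /\ ccol u = ccol v.
  by move: vu' uv'; clear; lia.
rewrite /crow /ccol => ruv cuv; apply: val_inj => /=.
by rewrite (surjective_pairing (ssval u)) ruv cuv -surjective_pairing.
Qed.

Lemma position_above u v : above u v -> position v = position u + width.
Proof.
rewrite /above => /andP[/eqP uv /eqP cuv]; rewrite /position uv cuv.
have := crow_le u; rewrite uv => /subnSK <-; rewrite mulSn; lia.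
Qed.

(** Within a row the distance is always below [width]; one row down, exactly when [v] is in a column
    left of [u]; two or more rows down, never. *)
Lemma attack_position u v : position u < position v ->
  attack u v = (position v < position u + width).
Proof.
move=> uv; have uvn : u != v by apply: contraTneq uv => ->; rewrite ltnn.
move: (uv); rewrite position_lt /precedes /attack /attack_down uvn /position.
move: (ccol_lt u) (ccol_lt v) (crow_le u) (crow_le v).
move: (crow u) (crow v) (ccol u) (ccol v) width height; clear.
move=> ru rv cu cv w h uw vw uh vh.
case: (ltngtP rv ru) => [lt|lt|->] //= ltc; last first.
  by rewrite -addnA ltn_add2l; lia.
have [->|ne] := eqVneq ru rv.+1.
  have -> : h - rv = (h - rv.+1).+1 by lia.
  by rewrite mulSn; lia.
have -> : h - rv = (h - ru) + (ru - rv.+2).+2 by lia.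
by rewrite mulnDl 2!mulSn; apply/idP/idP; [lia|nia].
Qed.

Local Open Scope ring_scope.

(** A descent at [u] takes [arm u] from inv and adds [(leg u).+1] to maj, whatever the entries
    are. *)
Definition pair_weight u v : Qqt :=
  if attack u v then qvar
  else if above u v then (qvar ^+ arm u)^-1 * tvar ^+ (leg u).+1 else 1.

(** A weight other than 1 forces distance at most [width]; a properly nested pair is strictly
    closer, hence attacking. *)
Lemma pair_weight_nested : nested_const position qvar pair_weight finset.setT.
Proof.
move=> a b x y _ _ _ _ ax xy yb xyab; have ab := leq_trans (leq_ltn_trans ax xy) yb.
rewrite /pair_weight attack_position // => cab.
have le_ab : (position b <= position a + width)%N.
  move: cab; case: ltnP => [/ltnW//|_]; case: (boolP (above a b)) => [/position_above ->//|].
  by rewrite eqxx.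
rewrite attack_position //; suff -> : (position y < position x + width)%N by [].
have : (position x != position a) || (position y != position b).
  by rewrite !(inj_eq position_inj) -negb_and.
by move: ax yb le_ab; clear; lia.
Qed.

Lemma qvar_neq0 : qvar != 0.
Proof. by rewrite tofrac_eq0 polyC_eq0 polyX_eq0. Qed.

(** Inversions sit at distance below [width] and descents at distance exactly [width], so each pair
    contributes to at most one of them. *)
Lemma filling_statistics (sigma : filling mu) :
  qvar ^ inv_fill sigma * tvar ^+ maj_fill sigma =
  \prod_u \prod_v
    (if (position u < position v)%N && (val (sigma v) < val (sigma u))%N
     then pair_weight u v else 1).
Proof.
pose d u : Qqt := (qvar ^+ arm u)^-1 * tvar ^+ (leg u).+1.
(* At most one cell lies directly below [u], so at most one factor is [d u]. *)
have desE u : \prod_v (if above u v && (val (sigma v) < val (sigma u))%N then d u else 1) =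
    if u \in Des sigma then d u else 1.
  rewrite inE; case: existsP => [[v uv]|no]; last first.
    by rewrite big1 // => v _; case: ifP => // uv; case: no; exists v.
  rewrite (bigD1 v) //= uv big1 ?mulr1 // => v' v'v; case: ifP => // /andP[uv' _].
  case/eqP: v'v; apply: position_inj; case/andP: uv => uv _.
  by rewrite (position_above uv) (position_above uv').
transitivity (\prod_u \prod_v (if (u, v) \in Defs.Inv sigma then qvar else 1) *
    \prod_u \prod_v (if above u v && (val (sigma v) < val (sigma u))%N then d u else 1)).
  under [X in _ = _ * X]eq_bigr do rewrite desE.
  rewrite -[X in _ = _ * X]big_mkcond big_split /= prodfV !prodrXr.
  rewrite pair_bigA /=; under [X in _ = X * _]eq_bigr do rewrite -surjective_pairing.
  rewrite -[X in _ = X * _]big_mkcond prodr_const mulrA; congr (_ * _).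
  by rewrite /inv_fill expfzDr ?qvar_neq0 // -exprnN.
rewrite -big_split; apply: eq_bigr => u _; rewrite -big_split; apply: eq_bigr => v _ /=.
rewrite inE /= -position_lt andbA [attack u v && _]andbC -andbA.
rewrite /pair_weight; case: (boolP (val (sigma v) < val (sigma u))%N) => _;
  rewrite ?andbF ?mulr1 // !andbT.
case: ltnP => [uv|vu] /=.
  case: ifP => // auv; last by rewrite mul1r.
  move: auv; rewrite attack_position // => lt.
  by case: (boolP (above u v)) => [/position_above|]; [move: lt; lia | rewrite mulr1].
case: (boolP (above u v)) => [/position_above|]; last by rewrite mulr1.
by move: vu; rewrite /width; lia.
Qed.

Definition letter (k : nat) : zpos := exist _ k.+1 (ltn0Sn k).

Lemma letterK (i : zpos) : letter (val i).-1 = i.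
Proof. by apply: val_inj; rewrite /= prednK // (valP i). Qed.

(** A filling with monomial [m] uses only letters from the support of [m], so a finite alphabet
    containing the support yields the whole coefficient. *)
Lemma Cmu_content_sum L (m : {cmonom zpos}) :
    (forall i, i \in finsupp m -> (val i <= L.+1)%N) ->
  Cmu mu m =
  content_sum position pair_weight (fun k : 'I_L.+1 => m (letter k)).
Proof.
move=> mL; pose h (s : {ffun cell mu -> 'I_L.+1}) : filling mu := [ffun u => letter (s u)].
have h_inj : injective h.
  move=> s s' /ffunP ss'; apply/ffunP => u; apply: val_inj.
  by have /(congr1 val) := ss' u; rewrite !ffunE /= => -[].
have contentE s : xmon (h s) = m <->
    [forall k : 'I_L.+1, #|letter_set s k| == m (letter k)].
  have cardE (k : 'I_L.+1) : #|letter_set s k| = xmon (h s) (letter k).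
    rewrite xmonE; apply: eq_card => u; rewrite !inE ffunE.
    apply/eqP/eqP => [->//|/(congr1 val) [] /val_inj //].
  split=> [sm|/forallP sm]; first by apply/forallP => k; rewrite cardE sm.
  apply/eqP/cmP => i; case: (leqP (val i) L.+1) => iL.
    have kL : ((val i).-1 < L.+1)%N by rewrite prednK // (valP i).
    by have /eqP := sm (Ordinal kL); rewrite cardE /= letterK.
  (* A letter beyond the alphabet has exponent 0 in [m] and does not occur in [h s]. *)
  have /eqP -> : m i == 0%N.
    by rewrite cmE_eq0; apply: contraL iL => /mL; rewrite leqNgt.
  apply/eqP; rewrite xmonE cards_eq0; apply/eqP/setP => u; rewrite !inE ffunE.
  by apply: contraTF iL => /eqP <-; rewrite -leqNgt /= ltn_ord.
pose r := [seq h s | s <- enum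
   [pred s : {ffun cell mu -> 'I_L.+1} | [forall k : 'I_L.+1, #|letter_set s k| == m (letter k)]]].
have fiberE : ([set sigma : filling mu | xmon sigma = m] = [set` r])%classic.
  apply/seteqP; split=> sigma /=; last first.
    by case/mapP => s; rewrite mem_enum inE => /contentE sm ->.
  move=> sm; have sL u : (val (sigma u) <= L.+1)%N.
    apply: mL; rewrite -cmE_neq0 -sm xmonE -lt0n card_gt0.
    by apply/set0Pn; exists u; rewrite inE.
  have sE : sigma = h [ffun u => inord (val (sigma u)).-1].
    apply/ffunP => u; rewrite !ffunE inordK ?letterK // prednK //; exact: valP.
  by rewrite {1}sE; apply: map_f; rewrite mem_enum inE; apply/contentE; rewrite -sE.
rewrite /Cmu fiberE -fsbig_seq ?map_inj_uniq ?enum_uniq // big_map big_enum_cond /=.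
rewrite /content_sum; apply: eq_big => [s|s _]; first by rewrite andbT.
rewrite filling_statistics /filling_weight; apply: eq_bigr => u _; apply: eq_bigr => v _.
by rewrite !ffunE.
Qed.

End Position.

(** * Renaming of variables, and the symmetry *)

Lemma renameE (w : zpos -> zpos) (m : {cmonom zpos}) (i : zpos) :
  injective w -> rename w m (w i) = m i.
Proof.
move=> w_inj; rewrite /rename.
rewrite (big_morph (fun m : {cmonom zpos} => m (w i))
          (fun m1 m2 => cmM (w i) m1 m2) (cm1 (w i))).
have expE k n : expcmn (ucm (w k)) n (w i) = ((k == i) * n)%N.
  elim: n => [|[|n] IHn]; first by rewrite muln0 [LHS]cm1.
    by rewrite muln1 [LHS]cmU (inj_eq w_inj).
  transitivity (ucm (w k) (w i) + expcmn (ucm (w k)) n.+1 (w i))%N; first exact: cmM.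
  by rewrite IHn cmU (inj_eq w_inj) [RHS]mulnS.
under eq_bigr do rewrite expE.
have [im|im] := boolP (i \in finsupp m).
  rewrite (big_fsetD1 i) //= eqxx mul1n big1_fset ?addn0 // => k.
  by rewrite in_fsetD1 => /andP[/negPf->].
rewrite big1_fset => [|k km _]; last first.
  by case: eqVneq => // ki; rewrite ki (negPf im) in km.
by apply/esym/eqP; rewrite cmE_eq0.
Qed.

(** This serves to compare monomials with different supports: up to order, only the nonzero
    exponents and the length of [s] matter. *)
Lemma perm_map_finsupp (m : {cmonom zpos}) (s : seq zpos) :
    uniq s -> {subset finsupp m <= s} ->
  perm_eq (map m s) (map m (finsupp m) ++ nseq (size s - size (finsupp m)) 0%N).
Proof.
move=> us sub.
have ps : perm_eq s (finsupp m ++ [seq x <- s | x \notin finsupp m]).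
  rewrite -(perm_filterC (mem (finsupp m)) s) perm_cat2r; apply: uniq_perm.
  - exact: filter_uniq.
  - exact: fset_uniq.
  - by move=> x; rewrite mem_filter; apply/andP/idP => [[]//|xm]; split=> //; exact: sub.
apply: perm_trans (perm_map m ps) _; rewrite map_cat perm_cat2l.
have /= -> := perm_size ps; rewrite size_cat addKn.
rewrite (_ : map m _ = nseq (size [seq x <- s | x \notin finsupp m]) 0%N) //.
rewrite -(size_map m); apply/all_pred1P; rewrite all_map; apply/allP => x.
by rewrite mem_filter /= cmE_eq0 => /andP[].
Qed.

Theorem theorem3p1 (mu : seq nat) (mu_partition : sorted geq mu) :
  symmetric_series (Cmu mu).
Proof.
move=> w w_bij m; have w_inj := bij_inj w_bij.
set m' := rename w m.
have supp' : finsupp m' =i map w (finsupp m).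
  move=> i; have [w' wK w'K] := w_bij; rewrite -[i]w'K (mem_map w_inj) -!cmE_neq0.
  by rewrite renameE.
(* [w] need not preserve any initial segment of the alphabet, so one bound is taken for both
   supports. *)
pose L := \max_(i <- finsupp m ++ finsupp m') val i.
have leL i : (i \in finsupp m) || (i \in finsupp m') -> (val i <= L.+1)%N.
  by rewrite -mem_cat => im; apply: leqW; exact: leq_bigmax_seq.
have mL i : i \in finsupp m -> (val i <= L.+1)%N by move=> im; apply: leL; rewrite im.
have m'L i : i \in finsupp m' -> (val i <= L.+1)%N by move=> im; apply: leL; rewrite im orbT.
rewrite (Cmu_content_sum mu mL) (Cmu_content_sum mu m'L).
pose s := [seq letter k | k : 'I_L.+1].
have us : uniq s by rewrite map_inj_uniq ?enum_uniq // => x y /(congr1 val) [] /val_inj.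
have mem_s i : (val i <= L.+1)%N -> i \in s.
  move=> iL; have kL : ((val i).-1 < L.+1)%N by rewrite prednK // (valP i).
  by apply/mapP; exists (Ordinal kL); rewrite ?mem_enum //= letterK.
have sub : {subset finsupp m <= s} by move=> i /mL/mem_s.
have sub' : {subset finsupp m' <= s} by move=> i /m'L/mem_s.
have psupp : perm_eq (finsupp m') (map w (finsupp m)).
  by apply: uniq_perm => //; rewrite ?map_inj_uniq ?fset_uniq.
have mm' : perm_eq (map m' s) (map m s).
  apply: perm_trans (perm_map_finsupp us sub') _.
  rewrite perm_sym; apply: perm_trans (perm_map_finsupp us sub) _.
  rewrite (perm_size psupp) (size_map w) perm_cat2r perm_sym.
  apply: perm_trans (perm_map m' psupp) _; rewrite -map_comp.
  by rewrite (@eq_map _ _ (m' \o w) m) // => i; apply: renameE.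
pose t := [tuple m (letter k) | k < L.+1].
(* [p] rearranges the exponents of [m] into those of [m']; it need not be a restriction of [w]. *)
have [p tp] : exists p : 'S_L.+1, map m' s = [tuple tnth t (p i) | i < L.+1].
  by apply/tuple_permP; rewrite /= -[X in perm_eq _ X]map_comp in mm' *.
rewrite -[RHS](content_sum_perm (@position_inj mu) (@pair_weight_nested mu) p).
apply: eq_content_sum => k /=.
have := congr1 (fun x => nth 0%N x k) tp.
rewrite -map_comp -tnth_nth !tnth_mktuple => <-.
by rewrite (nth_map k) ?size_enum_ord // nth_ord_enum.
Qed.
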